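(* Let $f:[0,1]\to\mathbb{R}$ be a smooth function which is flat at $x=0$, and for each integer $n\geq 0$ put $Z(n)=\{x\in(0,1)\mid f^{(n)}(x)=0\}$. Then the following hold. 1) $\displaystyle\lim_{n\to\infty}\inf Z(n)=0$. 2) For any integer $k>0$ there exist an integer $N>0$ and points $y^{(n)}(l)\in Z(n)$, for all integers $n\geq N$ and $l=1,\dots,k$, such that - for each fixed $n\geq N$, $y^{(n)}(l)<y^{(n)}(l+1)$ for $1\leq l\leq k-1$; - for each fixed $l\in\{1,\dots,k\}$, $y^{(n)}(l)>y^{(n+1)}(l)$ for all $n\geq N$; - for each $l\in\{1,\dots,k\}$, $\displaystyle\lim_{n\to\infty}y^{(n)}(l)=0$.
   Context: A smooth function means a function of class $C^\infty$ on the closed interval $[0,1]$ (one-sided derivatives at the endpoints). $f^{(n)}$ denotes the $n$-th derivative, with $f^{(0)}=f$. A smooth function $f$ on $[0,1]$ is flat at $0$ if $f^{(n)}(x)\to 0$ as $x\to 0+0$ for every integer $n\ge 0$ (equivalently, $f^{(n)}(0)=0$ for every $n\geq 0$). Convention: $\inf\emptyset=+\infty$, so that 1) includes the assertion that $Z(n)$ is nonempty for all sufficiently large $n$. *)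

(* Defs.v *)
From HB Require Import structures.
From mathcomp Require Import all_boot all_order all_algebra.
From mathcomp Require Import all_classical all_reals all_analysis.

Set Implicit Arguments.
Unset Strict Implicit.
Unset Printing Implicit Defensive.

Import Order.TTheory GRing.Theory Num.Theory.
Import numFieldNormedType.Exports.

Local Open Scope classical_set_scope.
Local Open Scope ring_scope.

(* A function f : [0,1] -> R is represented by a total function R -> R. All the
   notions below depend only on its values on [0,1]: difference quotients are
   taken along y -> x with y in [0,1] \ {x}. This is the ordinary derivative
   for 0 < x < 1, and the one-sided derivative for x = 0 and x = 1. *)
Definition diff_quot {R : realType} (f : R -> R) (x y : R) : R :=
  (f y - f x) / (y - x).

Definition derivable01 {R : realType} (f : R -> R) (x : R) : Prop :=
  cvg (diff_quot f x y @[y --> within `[0, 1] x^']).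

Definition derive01 {R : realType} (f : R -> R) (x : R) : R :=
  lim (diff_quot f x y @[y --> within `[0, 1] x^']).

Definition derive01n {R : realType} (n : nat) (f : R -> R) : R -> R :=
  iter n derive01 f.

Definition smooth01 {R : realType} (f : R -> R) : Prop :=
  forall (n : nat) (x : R), x \in `[0, 1] -> derivable01 (derive01n n f) x.

Definition flat_at0 {R : realType} (f : R -> R) : Prop :=
  forall n : nat, derive01n n f x @[x --> 0^'+] --> (0 : R).

Definition Z {R : realType} (f : R -> R) (n : nat) : set R :=
  [set x | 0 < x < 1 /\ derive01n n f x = 0].

(* Main.v *)
Require Import Defs.
From mathcomp Require Import all_boot all_order all_algebra.
From mathcomp Require Import all_classical all_reals all_analysis.
From mathcomp Require Import ring lra.
Import Order.TTheory GRing.Theory Num.Theory.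
Import numFieldNormedType.Exports.
Local Open Scope classical_set_scope.
Local Open Scope ring_scope.

Set Implicit Arguments.
Unset Strict Implicit.

(** Write F n for the n-th derivative of f; flatness means that every F n
    vanishes at 0. Everything rests on producing zeros near 0: for every k and
    every a > 0 some F n has k zeros in ]0, a[ ([zeros_near0]). Rolle's theorem,
    applied between 0 and the first zero and between consecutive zeros, then
    gives k zeros for all later n, each to the left of the corresponding
    previous one ([zeros_rolle]).

    The zeros are produced by induction on k. Suppose that F N has k zeros in
    ]0, a[, and follow them by Rolle's theorem: let w n be the largest one for
    F n, or 0 if k = 0. If no F n had a further zero in ]w n, a[, then each F n
    would have a constant sign there, and the same sign for all n, because
    F n (w n) = 0 and F n.+1 = (F n)'. Say the sign is positive. Then
       j F n x <= x F n.+1 x   on [w n, a[   for all j and n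
    ([flat_chain_growth]). With n and x fixed and j large, this contradicts
    F n x > 0. So some F n has a zero in ]w n, a[ ([flat_chain_vanishes]), which
    is the (k+1)-st one. The inequality plays the part of Bernstein's theorem,
    by which a function with nonnegative derivatives of all orders is analytic.

    The points y n l must in addition tend to 0, and Rolle's theorem alone does
    not force this. The pointwise minimum of two increasing k-tuples of zeros is
    again one, so each Rolle step can be combined with a tuple whose last entry
    is almost as small as possible at that level ([zeros_descent]); by
    [zeros_near0] the last entries then tend to 0 ([zeros_descent_to0]). The
    limit of the infima is the case k = 1. *)

(** * From derivatives on the closed interval to ordinary ones *)

Lemma derivable01_is_derive (R : realType) (f : R -> R) (x : R) :
  0 < x < 1 -> derivable01 f x -> is_derive x 1 f (derive01 f x).
Proof.
move=> /andP[x0 x1] fx.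
have shift : h + x @[h --> (0 : R)^'] --> within `[0, 1] x^'.
  move=> A; rewrite /within /= => /nbhs_ballP[e /= e0 eA].
  (* Within distance min (x, 1 - x) of x no point leaves [0, 1]. *)
  apply/nbhs_ballP; exists (Num.min e (Num.min x (1 - x))) => /=.
    by rewrite !lt_min e0 x0 subr_gt0 x1.
  move=> h; rewrite /ball /= sub0r normrN !lt_min => /andP[he /andP[hx hx1]] h0.
  apply: eA.
  - by rewrite /ball /= opprD addrCA subrr addr0 normrN.
  - by rewrite -subr_eq0 addrK.
  - rewrite /= in_itv /=; move: hx hx1; rewrite !ltr_norml => /andP[? ?] /andP[? ?].
    by apply/andP; split; lra.
have quot : h^-1 *: (f (h *: 1 + x) - f x) @[h --> (0 : R)^'] --> derive01 f x.
  apply: cvg_trans (cvg_comp _ _ shift fx).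
  by apply: near_eq_cvg; near=> h; rewrite /= /diff_quot addrK mulrC /GRing.scale /= mulr1.
split; first exact: cvgP quot.
exact: (cvg_lim _ quot).
Unshelve. all: by end_near. Qed.

(** Continuity at 0 identifies the value f^(n)(0) with the limit 0 that flatness
    prescribes. *)
Lemma derivable01_cvg_at0 (R : realType) (f : R -> R) :
  derivable01 f 0 -> f x @[x --> 0^'+] --> f 0.
Proof.
move=> f0.
have sub : (0 : R)^'+ `=>` within `[0, 1] (0 : R)^'.
  move=> A /nbhs_ballP[e /= e0 eA].
  apply/nbhs_ballP; exists (Num.min e 1) => /=; first by rewrite lt_min e0 ltr01.
  move=> h; rewrite /ball /= sub0r normrN lt_min => /andP[he h1] h0.
  apply: eA.
  - by rewrite /ball /= sub0r normrN.
  - by rewrite gt_eqF.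
  - by rewrite /= in_itv /= (ltW h0) ltW // (le_lt_trans (ler_norm _)).
have quot := cvg_trans (cvg_fmap2 (f := diff_quot f 0) sub) f0.
have id0 : (x : R) @[x --> 0^'+] --> (0 : R) by exact: (cvg_at_right_filter cvg_id).
(* f x = q x * x + f 0 for the difference quotient q, which converges. *)
have sum : diff_quot f 0 x * x + f 0 @[x --> 0^'+] --> f 0.
  rewrite -[X in _ --> X]add0r -[X in _ --> X + _](mulr0 (derive01 f 0)).
  by apply: cvgD; [exact: cvgM|exact: cvg_cst].
apply: cvg_trans sum; apply: near_eq_cvg; near=> x => /=.
by rewrite /diff_quot subr0 /= mulfVK ?subrK.
Unshelve. all: by end_near. Qed.

(** * Chains of derivatives vanishing at 0 *)

(** The successive derivatives of a flat function, as a bare sequence: unlike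
    flat functions with their iterated derivatives, such sequences can be
    shifted and negated without recomputing any derivative. *)
Definition flat_chain {R : realType} (F : nat -> R -> R) : Prop :=
  forall n, [/\ F n 0 = 0, F n x @[x --> 0^'+] --> (0 : R) &
    forall x : R, 0 < x < 1 -> is_derive x 1 (F n) (F n.+1 x)].

Lemma derive01n_flat_chain {R : realType} (f : R -> R) :
  smooth01 f -> flat_at0 f -> flat_chain (fun n => derive01n n f).
Proof.
move=> fs ff n; split; [|exact: ff|].
- apply: (cvg_unique _ _ (ff n)) => //.
  by apply: derivable01_cvg_at0; apply: fs; rewrite in_itv /= lexx ler01.
- move=> x x01; rewrite /derive01n iterS; apply: derivable01_is_derive => //.
  by apply: fs; case/andP: x01 => ? ?; rewrite in_itv /= !ltW.
Qed.

Section FlatChain.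
Context (R : realType).
Implicit Types (F : nat -> R -> R) (w s : nat -> R).

Lemma flat_chainN F : flat_chain F -> flat_chain (fun n x => - F n x).
Proof.
move=> cF n; have [F0 Fr Fd] := cF n; split; first by rewrite F0 oppr0.
- by rewrite -[X in _ --> X]oppr0; exact: cvgN.
- by move=> x x01; have := Fd x x01 => ?; exact: is_deriveN.
Qed.

Lemma flat_chain_shift F N : flat_chain F -> flat_chain (fun n => F (N + n)%N).
Proof. by move=> cF n; have [? ? ?] := cF (N + n)%N; split=> //; rewrite addnS. Qed.

Lemma flat_chain_continuous F n (u v : R) : flat_chain F -> 0 <= u -> v < 1 ->
  {within `[u, v], continuous (F n)}.
Proof.
move=> cF u0 v1; have [F0 Fr Fd] := cF n.
have Fc (x : R) : 0 < x < 1 -> F n z @[z --> x] --> F n x.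
  move=> x01; have [? _] := Fd x x01.
  exact/differentiable_continuous/derivable1_diffP.
have [uv|vu|<-] := ltgtP u v; last by rewrite set_itv1; exact: continuous_subspace1.
  apply/(continuous_within_itvP _ uv); split.
  - move=> x; rewrite in_itv /= => /andP[ux xv]; apply: Fc.
    by rewrite (le_lt_trans u0 ux) (lt_trans xv).
  - have [->|un0] := eqVneq u 0; first by rewrite F0.
    apply: cvg_at_right_filter; apply: Fc.
    by rewrite lt0r un0 u0 (lt_trans uv).
  - by apply: cvg_at_left_filter; apply: Fc; rewrite v1 (le_lt_trans u0).
by rewrite set_itv_ge ?bnd_simp -?ltNge //; exact: continuous_subspace0.
Qed.

(** By induction on j: the difference x F n.+1 x - (j+1) F n x has derivative
    x F n.+2 x - j F n.+1 x, which is nonnegative by the bound for j and n.+1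
    (this is why w has to be nonincreasing), and at w n it equals
    w n F n.+1 (w n) >= 0. *)
Lemma flat_chain_growth F w (a : R) : flat_chain F -> a <= 1 ->
  (forall n, 0 <= w n) -> (forall n, w n.+1 <= w n) ->
  (forall n, F n (w n) = 0) ->
  (forall n (x : R), w n < x < a -> 0 < F n x) ->
  forall j n (x : R), w n <= x < a -> j%:R * F n x <= x * F n.+1 x.
Proof.
move=> cF a1 w0 wS Fw Fpos.
have Fge0 n (x : R) : w n <= x < a -> 0 <= F n x.
  case/andP; rewrite le_eqVlt => /predU1P[<- _|wx xa]; first by rewrite Fw.
  by apply/ltW/Fpos; rewrite wx.
have xFge0 n (x : R) : w n <= x < a -> 0 <= x * F n.+1 x.
  move=> /andP[wx xa]; rewrite mulr_ge0 ?(le_trans (w0 n) wx) //.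
  by apply: Fge0; rewrite xa (le_trans (wS n) wx).
elim=> [|j IH] n x /[dup] wxa /andP[wx xa]; first by rewrite mul0r xFge0.
move: wx; rewrite le_eqVlt => /predU1P[wx|wx].
  by rewrite -{1}wx Fw mulr0 xFge0.
pose G x := x * F n.+1 x - j.+1%:R * F n x.
pose dG x := x * F n.+2 x - j%:R * F n.+1 x.
have x1 : x < 1 by rewrite (lt_le_trans xa).
have Gd c : c \in `]w n, x[ -> is_derive c 1 G (dG c).
  rewrite in_itv /= => /andP[wc cx].
  have c01 : 0 < c < 1 by rewrite (le_lt_trans (w0 n) wc) (lt_trans cx).
  have [_ _ /(_ c c01) d0] := cF n; have [_ _ /(_ c c01) d1] := cF n.+1.
  rewrite /G; apply: is_derive_eq; rewrite /dG /GRing.scale /= -natr1; ring.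
have Gc : {within `[w n, x], continuous G}.
  have idc : {within `[w n, x], continuous (fun z : R => z)}.
    by apply: continuous_subspaceT => z; exact: cvg_id.
  have Fc m : {within `[w n, x], continuous (F m)} by exact: flat_chain_continuous.
  move=> c; apply: cvgB; apply: cvgM.
  - exact: idc.
  - exact: Fc.
  - exact: cvg_cst.
  - exact: Fc.
have [c + Gx] := MVT wx Gd Gc.
rewrite in_itv /= => /andP[wc cx].
have Gw : 0 <= G (w n).
  by rewrite /G Fw mulr0 subr0 xFge0 // lexx (lt_trans wx).
have dGc : 0 <= dG c.
  by rewrite /dG subr_ge0 IH // (lt_trans cx xa) (le_trans (wS n)) // ltW.
rewrite -subr_ge0 -/(G x) -[G x](subrK (G (w n))) Gx.
by rewrite addr_ge0 // mulr_ge0 // subr_ge0 ltW.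
Qed.

Lemma flat_chain_not_pos F w (a : R) : flat_chain F -> a <= 1 ->
  (forall n, 0 <= w n) -> (forall n, w n.+1 <= w n) -> w 0%N < a ->
  (forall n, F n (w n) = 0) ->
  ~ (forall n (x : R), w n < x < a -> 0 < F n x).
Proof.
move=> cF a1 w0 wS wa Fw Fpos.
pose x := (w 0%N + a) / 2.
have wxa : w 0%N < x < a by rewrite /x; apply/andP; split; lra.
have Fx := Fpos 0%N x wxa.
pose j := Num.bound `|x * F 1%N x / F 0%N x|.
have : x * F 1%N x / F 0%N x < j%:R.
  exact: le_lt_trans (ler_norm _) (archi_boundP (normr_ge0 _)).
rewrite ltr_pdivrMr // ltNge => /negP; apply.
apply: (@flat_chain_growth F w a) => //.
by case/andP: wxa => /ltW -> ->.
Qed.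

Lemma flat_chain_const_sign F n (u a : R) : flat_chain F -> 0 <= u -> a <= 1 ->
  (forall x : R, u < x < a -> F n x != 0) ->
  (forall x : R, u < x < a -> 0 < F n x) \/ (forall x : R, u < x < a -> F n x < 0).
Proof.
move=> cF u0 a1 Fn0.
apply: contrapT => /not_orP[/existsNP[x /not_implyP[xu /negP +]]].
rewrite -leNgt => Fx /existsNP[y /not_implyP[yu /negP]]; rewrite -leNgt => Fy.
have IV (p q : R) : p <= q -> u < p -> q < a ->
    Num.min (F n p) (F n q) <= 0 <= Num.max (F n p) (F n q) -> False.
  move=> pq up qa /(IVT pq)[|c].
    apply: flat_chain_continuous => //; first by rewrite ltW // (le_lt_trans u0).
    exact: lt_le_trans qa a1.
  rewrite in_itv /= => /andP[pc cq] /eqP; apply/negP/Fn0.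
  by rewrite (lt_le_trans up) // (le_lt_trans cq).
case/andP: xu => ux xa; case/andP: yu => uy ya.
have [xy|yx] := leP x y.
  by apply: (IV x y) => //; rewrite ge_min le_max Fx Fy orbT.
by apply: (IV y x) => //; [exact: ltW|rewrite ge_min le_max Fx Fy orbT].
Qed.

(** A function that vanishes at u and is positive afterwards cannot have a
    negative derivative on all of ]u, a[. *)
Lemma flat_chain_pos_next F n (u v a : R) : flat_chain F -> 0 <= v -> v <= u ->
  u < a -> a <= 1 -> F n u = 0 -> (forall x : R, u < x < a -> 0 < F n x) ->
  (forall x : R, v < x < a -> F n.+1 x != 0) ->
  forall x : R, v < x < a -> 0 < F n.+1 x.
Proof.
move=> cF v0 vu ua a1 Fu Fpos Fn0.
have [//|Fneg] := flat_chain_const_sign cF v0 a1 Fn0.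
pose x := (u + a) / 2.
have [ux xa] : u < x /\ x < a by rewrite /x; split; lra.
have [||c] := @MVT _ (F n) (F n.+1) u x ux.
- move=> c; rewrite in_itv /= => /andP[uc cx]; have [_ _ Fd] := cF n; apply: Fd.
  by rewrite (le_lt_trans _ uc) ?(le_trans v0) //= (lt_trans cx) // (lt_le_trans xa).
- by apply: flat_chain_continuous => //; [exact: le_trans vu|exact: lt_le_trans a1].
rewrite in_itv /= Fu subr0 => /andP[uc cx] Fx.
have : 0 < F n x by apply: Fpos; rewrite ux.
rewrite Fx pmulr_lgt0 ?subr_gt0 // ltNge => /negP[].
by apply/ltW/Fneg; rewrite ?(le_lt_trans vu uc) ?(lt_trans cx xa).
Qed.

(** The mechanism that creates new zeros: w n stands for the last known zero of
    F n, and a further one must appear at some level n. With w = 0 this says that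
    the derivatives of a flat function cannot all avoid 0 on ]0, a[. *)
Lemma flat_chain_vanishes F w (a : R) : flat_chain F -> a <= 1 ->
  (forall n, 0 <= w n) -> (forall n, w n.+1 <= w n) -> w 0%N < a ->
  (forall n, F n (w n) = 0) ->
  exists n x, w n < x < a /\ F n x = 0.
Proof.
move=> cF a1 w0 wS wa Fw; apply: contrapT => noz.
have Fn0 n (x : R) : w n < x < a -> F n x != 0.
  by move=> wxa; apply/eqP => Fx; apply: noz; exists n, x.
have wna n : w n < a by elim: n => // n; exact: le_lt_trans.
have pos G : flat_chain G -> (forall n, G n (w n) = 0) ->
    (forall n (x : R), w n < x < a -> G n x != 0) ->
    ~ (forall x : R, w 0%N < x < a -> 0 < G 0%N x).
  move=> cG Gw Gn0 G0; apply: (@flat_chain_not_pos G w a) => //.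
  elim=> // n Gn; apply: (@flat_chain_pos_next G n (w n)) => //; exact: Gn0.
have [Fp|Fneg] := flat_chain_const_sign cF (w0 _) a1 (Fn0 0%N).
  exact: pos Fp.
apply: (pos (fun n x => - F n x)); first exact: flat_chainN.
- by move=> n; rewrite Fw oppr0.
- by move=> n x /Fn0; rewrite oppr_eq0.
- by move=> x /Fneg; rewrite oppr_gt0.
Qed.

(** * Tuples of zeros *)

(** The k zeros are s 1, ..., s k. The endpoint s 0 = 0 is prepended because it is
    a zero of every member of a flat chain, so that Rolle's theorem applies
    uniformly to the k intervals between consecutive entries. *)
Definition zeros (g : R -> R) (k : nat) (s : nat -> R) : Prop :=
  [/\ s 0%N = 0, forall i, (i < k)%N -> s i < s i.+1, s k < 1 &
      forall i, (i <= k)%N -> g (s i) = 0].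

Lemma zeros_le g k s i j : zeros g k s -> (i <= j <= k)%N -> s i <= s j.
Proof.
move=> [_ sS _ _]; elim: j => [|j IH]; first by rewrite leqn0 andbT => /eqP ->.
rewrite leq_eqVlt => /andP[/predU1P[-> //|ij] jk].
by apply: (le_trans (IH _)); [rewrite -ltnS ij ltnW|exact/ltW/sS].
Qed.

Lemma zeros_ge0 g k s i : zeros g k s -> (i <= k)%N -> 0 <= s i.
Proof. by move=> zs ik; have [<- _ _ _] := zs; exact: zeros_le zs _. Qed.

Lemma zeros_rolle F n k s : flat_chain F -> zeros (F n) k s ->
  exists t, zeros (F n.+1) k t /\ (forall i, (0 < i <= k)%N -> t i < s i).
Proof.
move=> cF zs; have [s0 sS sk sz] := zs.
have between i : exists c, (i < k)%N -> s i < c < s i.+1 /\ F n.+1 c = 0.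
  have [ik|] := boolP (i < k)%N; last by exists 0.
  have i0 : 0 <= s i by rewrite (zeros_ge0 zs) // ltnW.
  have i1 : s i.+1 < 1 by rewrite (le_lt_trans _ sk) // (zeros_le zs) // ik leqnn.
  have [||c] := @MVT _ (F n) (F n.+1) _ _ (sS i ik).
  - move=> c; rewrite in_itv /= => /andP[ic ci]; have [_ _ Fd] := cF n; apply: Fd.
    by rewrite (le_lt_trans i0 ic) (lt_trans ci).
  - exact: flat_chain_continuous.
  rewrite in_itv /= sz // sz 1?ltnW // subrr => cI /esym/eqP.
  rewrite mulf_eq0 subr_eq0 (gt_eqF (sS i ik)) orbF => /eqP Fc.
  by exists c.
have [c cP] := choice between.
exists (fun i => if i is j.+1 then c j else 0); split; last first.
  by case=> // i ik; have [/andP[]] := cP i ik.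
split=> //.
- case=> [|i] ik; have [/andP[sc _] _] := cP _ ik; first by rewrite -s0.
  by have [/andP[_ cs] _] := cP i (ltnW ik); exact: lt_trans sc.
- case: k sk cP {zs sS sz between} => // k sk cP.
  by have [/andP[_ cs] _] := cP k (ltnSn k); exact: lt_trans sk.
- case=> [|i] ik; first by have [] := cF n.+1.
  by have [] := cP i ik.
Qed.

Lemma zeros_min g k r s : zeros g k r -> zeros g k s ->
  zeros g k (fun i => Num.min (r i) (s i)).
Proof.
move=> [r0 rS rk rz] [s0 sS sk sz]; split.
- by rewrite r0 s0 minxx.
- by move=> i ik; rewrite lt_min !gt_min rS // sS // orbT.
- by rewrite gt_min rk.
- by move=> i ik; case: (leP (r i) (s i)) => _; [exact: rz|exact: sz].
Qed.

(** Zeros may accumulate or fill intervals, so a tuple with the smallest possible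
    last entry need not exist; one that is optimal up to e does. *)
Lemma zeros_near_inf g k s (e : R) : 0 < e -> zeros g k s ->
  exists u, zeros g k u /\ (forall v, zeros g k v -> u k < v k + e).
Proof.
move=> e0 zs; pose E := [set u k | u in zeros g k].
have Elb : has_lbound E.
  by exists 0 => _ [u zu <-]; exact: zeros_ge0 zu _.
have [|_ [u zu <-] ue] := @inf_adherent _ E e e0.
  by split=> //; exists (s k), s.
exists u; split=> // v zv; apply: (lt_le_trans ue); rewrite lerD2r.
by apply: ge_inf => //; exists v.
Qed.

(** The minimum of a Rolle tuple and a near-optimal tuple inherits both virtues:
    it lies strictly below the previous tuple and has a near-optimal last
    entry. *)
Lemma zeros_descent F N k s : flat_chain F -> zeros (F N) k s ->
  exists S : nat -> nat -> R,
    [/\ S 0%N = s,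
        forall n, zeros (F (N + n)%N) k (S n),
        forall n i, (0 < i <= k)%N -> S n.+1 i < S n i &
        forall n v, zeros (F (N + n.+1)%N) k v -> S n.+1 k < v k + n.+1%:R^-1].
Proof.
move=> cF zs.
have next (n : nat) (u : nat -> R) : exists t, zeros (F (N + n)%N) k u ->
    [/\ zeros (F (N + n.+1)%N) k t, (forall i, (0 < i <= k)%N -> t i < u i) &
        forall v, zeros (F (N + n.+1)%N) k v -> t k < v k + n.+1%:R^-1].
  have [zu|] := pselect (zeros (F (N + n)%N) k u); last by exists u.
  have e0 : 0 < n.+1%:R^-1 :> R by rewrite invr_gt0.
  have [r [zr ru]] := zeros_rolle cF zu; rewrite -addnS in zr.
  have [t [zt te]] := zeros_near_inf e0 zr.
  exists (fun i => Num.min (r i) (t i)) => _; split.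
  - exact: zeros_min.
  - by move=> i ik; rewrite gt_min ru.
  - by move=> v zv; rewrite gt_min te ?orbT.
have [step stepP] := choice (fun nu : nat * (nat -> R) => next nu.1 nu.2).
pose S := fix S n := if n is m.+1 then step (m, S m) else s.
have zS n : zeros (F (N + n)%N) k (S n).
  by elim: n => [|n IH]; [rewrite addn0|have [] := stepP (n, S n) IH].
by exists S; split=> // n; have [] := stepP (n, S n) (zS n).
Qed.

(** For the induction step, [flat_chain_vanishes] is applied to the last entries of
    a descending sequence of k-tuples; the zero that it gives becomes the
    (k+1)-st entry. *)
Lemma zeros_near0 F k (a : R) : flat_chain F -> 0 < a -> a <= 1 ->
  exists n s, zeros (F n) k s /\ s k < a.
Proof.
move=> cF a0 a1; elim: k => [|k [N [s [zs sa]]]].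
  exists 0%N, (fun=> 0); split=> //; split=> // i _.
  by have [] := cF 0%N.
have [S [S0 zS Slt _]] := zeros_descent cF zs.
have [||||||n [x [/andP[wx xa] Fx]]] :=
    @flat_chain_vanishes (fun n => F (N + n)%N) (fun n => S n k) a.
- exact: flat_chain_shift.
- by [].
- by move=> n; exact: zeros_ge0 (zS n) _.
  (* The entries of index at least 1 decrease strictly; entry 0 is always 0. *)
- move=> n; have [k0|k0] := posnP k; last by rewrite ltW // Slt // k0 leqnn.
  by rewrite k0; have [-> _ _ _] := zS n; have [-> _ _ _] := zS n.+1.
- by rewrite S0.
- by move=> n; have [_ _ _ tz] := zS n; exact: tz.
have [t0 tS t1 tz] := zS n.
exists (N + n)%N, (fun i => if (i <= k)%N then S n i else x).
rewrite ltnn xa; split=> //; split=> //.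
- move=> i; rewrite ltnS => ik; rewrite ik; case: ltnP => ki; first exact: tS.
  by have -> : i = k by apply/eqP; rewrite eqn_leq ik.
- by rewrite ltnn (lt_le_trans xa).
- by move=> i ik; case: leqP => // ?; exact: tz.
Qed.

Lemma zeros_persist F n m k s : flat_chain F -> (n <= m)%N -> zeros (F n) k s ->
  exists t, zeros (F m) k t /\ t k <= s k.
Proof.
move=> cF nm zs; have [S [S0 zS Slt _]] := zeros_descent cF zs.
exists (S (m - n)%N); rewrite -{1}(subnKC nm); split=> //.
have [k0|k0] := posnP k.
  by rewrite k0; have [-> _ _ _] := zS (m - n)%N; have [-> _ _ _] := zs.
elim: (m - n)%N => [|j IH]; first by rewrite S0.
by apply: le_trans IH; rewrite ltW // Slt // k0 leqnn.
Qed.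

Lemma zeros_descent_to0 F k : flat_chain F ->
  exists N (y : nat -> nat -> R),
    [/\ forall n, (N <= n)%N -> zeros (F n) k (y n),
        forall n i, (N <= n)%N -> (0 < i <= k)%N -> y n.+1 i < y n i &
        forall i, (i <= k)%N -> y n i @[n --> \oo] --> (0 : R)].
Proof.
move=> cF.
have [N [s [zs _]]] := zeros_near0 k cF ltr01 (lexx _).
have [S [_ zS Slt Sinf]] := zeros_descent cF zs.
exists N, (fun n => S (n - N)%N); split.
- by move=> n Nn; have := zS (n - N)%N; rewrite subnKC.
- by move=> n i Nn; rewrite subSn //; exact: Slt.
move=> i ik; suff Si0 : S n i @[n --> \oo] --> (0 : R).
  by rewrite -(cvg_shiftn N) /=; under eq_fun do rewrite addnK.
rewrite -(cvg_shiftS (S^~ i)).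
apply/cvgrPdist_lt => e e0.
have [||m [u [zu]]] := @zeros_near0 F k (Num.min (e / 2) 1) cF.
- by rewrite lt_min ltr01 divr_gt0.
- by rewrite ge_min lexx orbT.
rewrite lt_min => /andP[ue _].
near=> n.
(* Some tuple at level m ends below e / 2; it persists to level N + n.+1, where
   S n.+1 is optimal up to n.+1^-1 < e / 2. *)
have mn : (m <= N + n.+1)%N.
  apply: (@leq_trans n); first by near: n; exact: nbhs_infty_ge.
  by rewrite addnS ltnW // ltnS leq_addl.
have [v [zv vu]] := zeros_persist cF mn zu.
have S0 := zeros_ge0 (zS n.+1) ik.
have Si : S n.+1 i <= S n.+1 k by apply: (zeros_le (zS n.+1)); rewrite ik leqnn.
have Se := Sinf n v zv.
have ne : n.+1%:R^-1 < e / 2.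
  by near: n; have := near_infty_natSinv_lt (PosNum (divr_gt0 e0 (ltr0n R 2))).
rewrite sub0r normrN ger0_norm //; apply: (le_lt_trans Si); apply: (lt_trans Se).
by rewrite [e]splitr ltrD // (le_lt_trans vu).
Unshelve. all: by end_near. Qed.

End FlatChain.

(** * Zeros of the derivatives *)

Lemma zeros_in_Z (R : realType) (f : R -> R) n k s l :
  zeros (derive01n n f) k s -> (0 < l <= k)%N -> Z f n (s l).
Proof.
move=> zs /andP[l0 lk]; have [s0 sS s1 sz] := zs; split; last exact: sz.
rewrite (le_lt_trans (zeros_le zs _) s1) ?lk ?leqnn // andbT.
rewrite -{1}s0 (lt_le_trans (sS _ (leq_trans l0 lk))) //.
by apply: (zeros_le zs); rewrite l0.
Qed.

Unset Implicit Arguments.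
Set Strict Implicit.

(* The infimum is taken in the extended reals, where ereal_inf set0 = +oo. *)
Theorem corollary3 (R : realType) (f : R -> R)
  (f_smooth : smooth01 f) (f_flat : flat_at0 f) :
  (ereal_inf [set x%:E | x in Z f n] @[n --> \oo] --> (0 : R)%:E) /\
  (forall k : nat, (0 < k)%N ->
    exists (N : nat) (y : nat -> nat -> R),
      [/\ (0 < N)%N,
          (forall n l : nat, (N <= n)%N -> (1 <= l <= k)%N -> Z f n (y n l)),
          (forall n l : nat, (N <= n)%N -> (1 <= l <= k.-1)%N ->
             y n l < y n l.+1),
          (forall n l : nat, (N <= n)%N -> (1 <= l <= k)%N ->
             y n.+1 l < y n l) &
          (forall l : nat, (1 <= l <= k)%N ->
             y n l @[n --> \oo] --> (0 : R))]).
Proof.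
have cF := derive01n_flat_chain f_smooth f_flat.
split.
  have [N [y [zy _ y0]]] := zeros_descent_to0 1 cF.
  apply: (@squeeze_cvge _ _ _ _ (fun=> 0%:E) _ (fun n => (y n 1%N)%:E)).
  - near=> n; apply/andP; split.
      by apply: le_ereal_inf_tmp => _ [x [/andP[/ltW x0 _] _] <-]; rewrite lee_fin.
    apply: ereal_inf_lbound; exists (y n 1%N) => //.
    apply: (@zeros_in_Z _ _ _ 1) => //; apply: zy.
    by near: n; exact: nbhs_infty_ge.
  - exact: cvg_cst.
  - by apply: cvg_EFin; [exact: nearW|exact: y0].
move=> k k0; have [N [y [zy ylt y0]]] := zeros_descent_to0 k cF.
(* N itself may be 0. *)
exists N.+1, y; split=> //.
- by move=> n l /ltnW Nn lk; exact: zeros_in_Z (zy n Nn) _.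
- move=> n l /ltnW Nn /andP[_ lk]; have [_ tS _ _] := zy n Nn; apply: tS.
  by rewrite -(prednK k0) ltnS.
- by move=> n l /ltnW; exact: ylt.
- by move=> l /andP[_ lk]; exact: y0.
Unshelve. all: by end_near. Qed.
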